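(* Let $\alpha<\gamma$ be probability levels and let $\nu^*=\min_{(x,T(x))\in\mathcal X_T}\mathbb E_{\alpha-\gamma}[\mathbb T(x)]$. If $\delta,\delta'\ge0$ are chosen so that, with $\widetilde\alpha=\alpha+\delta$ and $\widetilde\gamma=\gamma+\delta'$ (again probability levels), $\widetilde\alpha<\widetilde\gamma$, then $$\nu^*\le\min_{(x,T(x))\in\mathcal X_T}\mathbb E_{\widetilde\alpha-\widetilde\gamma}[\mathbb T(x)].$$
   Context: Let $\mathcal X\subseteq\mathbb R^k$ be nonempty and let $Y$ be a discrete random vector in $\mathbb R^m$ having $n$ distinct realizations (atoms) $y_1,\dots,y_n$ with probabilities $p_1,\dots,p_n$ ($p_i>0$, $\sum_ip_i=1$). Let $f:\mathcal X\times\mathbb R^m\to\mathbb R$ be such that for each fixed realization $y$ of $Y$, $f(x,y)$ is linear in $x$. For $x\in\mathcal X$ put $\mathbb T(x)=f(x,Y)$, $T_i(x)=f(x,y_i)$, $T(x)=(T_1(x),\dots,T_n(x))$; $\mathbb T(x)$ takes the values $T_i(x)$ with associated probabilities $p_i$. Let $F(t)=\mathbb P(\mathbb T(x)\le t)$ and $F^{-1}(p)=\inf\{t:F(t)\ge p\}$. Probability levels are numbers in $[0,1]$. The constraints $x\in\mathcal X$ and $T_i(x)=f(x,y_i)$, $i=1,\dots,n$, are represented as $Ax+BT(x)\le c$ with $A\in\mathbb R^{l\times k}$, $B\in\mathbb R^{l\times n}$, $c\in\mathbb R^l$, and $\mathcal X_T=\{(x,T(x)):Ax+BT(x)\le c\}$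 is assumed nonempty, closed and convex. Here $\min$ of an optimization problem denotes its optimal value. For $0\le\alpha<1$, $\mathbb E_{\alpha-1}[\mathbb T(x)]=\frac1{1-\alpha}\max\{\sum_iT_i(x)w_ip_i:w\in[0,1]^n,\sum_iw_ip_i=1-\alpha\}$. For $0\le\alpha<\gamma\le1$, $\mathbb E_{\alpha-\gamma}[\mathbb T(x)]=\frac1{\gamma-\alpha}\big((1-\alpha)\mathbb E_{\alpha-1}[\mathbb T(x)]-(1-\gamma)\mathbb E_{\gamma-1}[\mathbb T(x)]\big)$ (last term $0$ if $\gamma=1$); equivalently $\frac1{\gamma-\alpha}\int_\alpha^\gamma F^{-1}(p)\,dp$. *)

(* Defs.v *)
From HB Require Import structures.
From mathcomp Require Export all_boot all_order all_algebra.
From mathcomp Require Export all_classical all_reals all_analysis.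
Export numFieldNormedType.Exports.

Set Implicit Arguments.
Unset Strict Implicit.
Unset Printing Implicit Defensive.
Import Order.TTheory GRing.Theory Num.Theory.

Local Open Scope classical_set_scope.
Local Open Scope ring_scope.

(* Y need not take only the values y i, but it does so almost surely since the
   p i sum to 1.  Measurability of every coordinate of Y is Borel measurability
   of Y for the product topology of R^m. *)
Definition discrete_random_vector (R : realType) (d : measure_display)
    (Omega : measurableType d) (P : probability Omega R) (m n : nat)
    (Y : Omega -> 'cV[R]_m) (y : 'I_n -> 'cV[R]_m) (p : 'I_n -> R) : Prop :=
  [/\ forall j, measurable_fun [set: Omega] (fun omega => Y omega j 0),
      injective y,
      forall i, P (Y @^-1` [set y i]) = (p i)%:E,
      forall i, 0 < p i &
      \sum_i p i = 1].

Definition linear_on (R : realType) (k : nat) (X : set 'cV[R]_k)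
    (h : 'cV[R]_k -> R) : Prop :=
  exists g : {linear 'cV[R]_k -> R^o}, forall x, X x -> h x = g x.

Definition realizations (R : realType) (k m n : nat)
    (f : 'cV[R]_k -> 'cV[R]_m -> R) (y : 'I_n -> 'cV[R]_m) (x : 'cV[R]_k)
    : 'cV[R]_n :=
  \col_i f x (y i).

Definition in_polyhedron (R : realType) (k n l : nat) (A : 'M[R]_(l, k))
    (B : 'M[R]_(l, n)) (c : 'cV[R]_l) (x : 'cV[R]_k) (t : 'cV[R]_n) : Prop :=
  forall i, (A *m x + B *m t) i 0 <= c i 0.

(* The system in the joint unknowns (x, t) encodes both the constraint x \in X
   and the n equations t_i = f(x, y_i). *)
Definition represents (R : realType) (k m n l : nat) (X : set 'cV[R]_k)
    (f : 'cV[R]_k -> 'cV[R]_m -> R) (y : 'I_n -> 'cV[R]_m)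
    (A : 'M[R]_(l, k)) (B : 'M[R]_(l, n)) (c : 'cV[R]_l) : Prop :=
  forall x t, in_polyhedron A B c x t <-> X x /\ t = realizations f y x.

Definition feasible_set (R : realType) (k m n l : nat)
    (f : 'cV[R]_k -> 'cV[R]_m -> R) (y : 'I_n -> 'cV[R]_m)
    (A : 'M[R]_(l, k)) (B : 'M[R]_(l, n)) (c : 'cV[R]_l)
    : set ('cV[R]_k * 'cV[R]_n) :=
  [set (x, realizations f y x) | x in
    [set x | in_polyhedron A B c x (realizations f y x)]].

Definition tail_weights (R : realType) (n : nat) (p : 'I_n -> R) (alpha : R)
    : set ('I_n -> R) :=
  [set w | (forall i, 0 <= w i <= 1) /\ \sum_i w i * p i = 1 - alpha].

(* E_{alpha-1} of the random variable with values t_i and probabilities p_i,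
   for 0 <= alpha < 1.  The supremum is a maximum: it is that of a linear
   function over a nonempty compact set. *)
Definition tail_mean (R : realType) (n : nat) (p : 'I_n -> R) (t : 'cV[R]_n)
    (alpha : R) : R :=
  (1 - alpha)^-1 *
  sup [set \sum_i t i 0 * w i * p i | w in tail_weights p alpha].

(* E_{alpha-gamma}, for 0 <= alpha < gamma <= 1.  At gamma = 1 the second term
   is 0 because of its factor 1 - gamma, whatever the value of tail_mean. *)
Definition range_mean (R : realType) (n : nat) (p : 'I_n -> R) (t : 'cV[R]_n)
    (alpha gamma : R) : R :=
  (gamma - alpha)^-1 *
  ((1 - alpha) * tail_mean p t alpha - (1 - gamma) * tail_mean p t gamma).

(* Extended-real valued: -oo when the problem is unbounded below. *)
Definition optimal_value (R : realType) (T : Type) (S : set T) (obj : T -> R)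
    : \bar R :=
  ereal_inf [set (obj s)%:E | s in S].

(* Main.v *)
Require Import Defs.
From mathcomp Require Import ring lra.

Set Implicit Arguments.
Unset Strict Implicit.
Unset Printing Implicit Defensive.
Import Order.TTheory GRing.Theory Num.Theory.
Local Open Scope classical_set_scope.
Local Open Scope ring_scope.

(** The inequality already holds pointwise: for a fixed vector [t] of values,
    the mean over the levels from [alpha] to [gamma] does not decrease when
    both levels are raised, so neither does its infimum over the feasible set.

    Write [S a] for the largest value of [\sum_i t_i w_i p_i] over the weights
    with total mass [1 - a], that is [(1 - a)] times the tail mean at [a].
    Then [range_mean] is [(S alpha - S gamma) / (gamma - alpha)], the slope of
    a chord of [- S].  As the optimal value of a linear program, as a function
    of its right-hand side, [S] is concave: averaging weights of masses
    [1 - u] and [1 - w] gives weights of the averaged mass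
    ([tail_sup_concave]).  The slope of a chord of the convex function [- S]
    does not decrease as either endpoint moves to the right
    ([concave_chord_le]), which is the claim.
    Working with concavity of [S] avoids describing the maximizing weights or
    the quantile function of which [S] is an integral. *)

(** The chord from [u] to [w] lies below the graph at [v]; multiplying by
    [w - u] keeps the inequality free of divisions. *)
Definition concave_between (R : realFieldType) (lo hi : R) (S : R -> R) : Prop :=
  forall u v w, lo <= u -> u < v -> v < w -> w <= hi ->
    (w - v) * S u + (v - u) * S w <= (w - u) * S v.

Lemma concave_chord_le (R : realFieldType) (lo hi : R) (S : R -> R)
    (u v u' v' : R) :
  concave_between lo hi S -> lo <= u -> v' <= hi ->
  u <= u' -> v <= v' -> u < v -> u' < v' ->
  (v - u)^-1 * (S u - S v) <= (v' - u')^-1 * (S u' - S v').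
Proof.
move=> cS lou vhi uu vv uv uv'.
(* Both chords are compared with the one over the outer interval, which shares
   an endpoint with each of them. *)
apply: (@le_trans _ _ ((v' - u)^-1 * (S u - S v'))).
  move: vv; rewrite le_eqVlt => /predU1P[->//|vv].
  have h := cS _ _ _ lou uv vv vhi.
  rewrite ler_pdivrMl ?subr_gt0// mulrCA ler_pdivlMl ?subr_gt0; last by lra.
  nra.
move: uu; rewrite le_eqVlt => /predU1P[->//|uu].
have h := cS _ _ _ lou uu uv' vhi.
rewrite ler_pdivrMl ?subr_gt0; last by lra.
rewrite mulrCA ler_pdivlMl ?subr_gt0//.
nra.
Qed.

Lemma ge_sup_comb (R : realType) (E F : set R) (a b c : R) :
  E !=set0 -> F !=set0 -> 0 < a -> 0 < b ->
  (forall x y, E x -> F y -> a * x + b * y <= c) ->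
  a * sup E + b * sup F <= c.
Proof.
move=> E0 F0 a0 b0 H.
rewrite -lerBrDr -ler_pdivlMl//; apply: ge_sup => // x Ex.
rewrite ler_pdivlMl// lerBrDr addrC -lerBrDr -ler_pdivlMl//.
apply: ge_sup => // y Fy.
by rewrite ler_pdivlMl// lerBrDr addrC; exact: H.
Qed.

Section TailSup.
Variables (R : realType) (n : nat) (p : 'I_n -> R) (t : 'cV[R]_n).
Hypotheses (p_gt0 : forall i, 0 < p i) (p_sum1 : \sum_i p i = 1).

Let tail_values (a : R) : set R :=
  [set \sum_i t i 0 * w i * p i | w in tail_weights p a].

Let tail_sup (a : R) : R := sup (tail_values a).

Lemma tail_values_nonempty (a : R) : 0 <= a -> a <= 1 -> tail_values a !=set0.
Proof.
move=> a0 a1; exists (\sum_i t i 0 * (1 - a) * p i), (fun=> 1 - a) => //.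
split=> [i|]; first by apply/andP; split; lra.
by rewrite -mulr_sumr p_sum1 mulr1.
Qed.

Lemma tail_values_bounded (a : R) : has_ubound (tail_values a).
Proof.
exists (\sum_i `|t i 0| * p i) => _ [w [w01 _] <-].
apply: ler_sum => i _; rewrite ler_pM2r//.
have /andP[w0 w1] := w01 i.
by rewrite (le_trans (ler_norm _))// normrM (ger0_norm w0) ler_piMr.
Qed.

Lemma tail_sup_concave : concave_between 0 1 tail_sup.
Proof.
move=> u v w u0 uv vw w1.
have wu : 0 < w - u by lra.
apply: ge_sup_comb; try lra; try by apply: tail_values_nonempty; lra.
move=> _ _ [q [q01 qu] <-] [r [r01 rw] <-].
rewrite -ler_pdivrMl//.
apply: (ub_le_sup (tail_values_bounded v)).
exists (fun i => (w - u)^-1 * ((w - v) * q i + (v - u) * r i)).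
  split=> [i|].
    have /andP[? ?] := q01 i; have /andP[? ?] := r01 i.
    by rewrite ler_pdivlMl// ler_pdivrMl// mulr0 mulr1; apply/andP; split; nra.
  rewrite [LHS](_ : _ =
    (w - u)^-1 * ((w - v) * (\sum_i q i * p i) + (v - u) * \sum_i r i * p i)).
    by rewrite qu rw; field; rewrite gt_eqF.
  rewrite !mulr_sumr -big_split mulr_sumr; apply: eq_bigr => i _ /=; ring.
rewrite !mulr_sumr -big_split mulr_sumr; apply: eq_bigr => i _ /=; ring.
Qed.

(** At level [1] the tail mean is divided by [1 - 1]; the identity survives
    because zero total mass forces every weighted value to vanish. *)
Lemma tail_sup_mean (a : R) : a <= 1 -> (1 - a) * tail_mean p t a = tail_sup a.
Proof.
rewrite le_eqVlt => /predU1P[->|a1]; last first.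
  by rewrite /tail_mean mulrA mulfV ?mul1r// subr_eq0 gt_eqF.
rewrite subrr mul0r /tail_sup -[LHS]sup1; congr sup.
apply/seteqP; split=> [_ ->|_ [w [w01 ws] <-]] /=.
  exists (fun=> 0); last by rewrite big1// => i _; rewrite mulr0 mul0r.
  by split=> [i|]; rewrite ?lexx ?ler01// subrr big1// => i _; rewrite mul0r.
rewrite big1// => i _; rewrite -mulrA.
have wp0 j : true -> 0 <= w j * p j.
  by move=> _; have /andP[? _] := w01 j; rewrite mulr_ge0// ltW.
move: ws; rewrite subrr => /(psumr_eq0P wp0) ->//.
by rewrite mulr0.
Qed.

Lemma range_mean_le (a g a' g' : R) :
  0 <= a -> g' <= 1 -> a <= a' -> g <= g' -> a < g -> a' < g' ->
  range_mean p t a g <= range_mean p t a' g'.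
Proof.
move=> a0 g1 aa gg ag ag'; rewrite /range_mean !tail_sup_mean; try lra.
exact: (concave_chord_le tail_sup_concave).
Qed.

End TailSup.

Theorem proposition6 (R : realType) (d : measure_display)
    (Omega : measurableType d) (P : probability Omega R)
    (k m n l : nat) (X : set 'cV[R]_k)
    (Y : Omega -> 'cV[R]_m) (y : 'I_n -> 'cV[R]_m) (p : 'I_n -> R)
    (f : 'cV[R]_k -> 'cV[R]_m -> R)
    (A : 'M[R]_(l, k)) (B : 'M[R]_(l, n)) (c : 'cV[R]_l)
    (alpha gamma delta delta' : R)
    (X_nonempty : X !=set0)
    (Y_discrete : discrete_random_vector P Y y p)
    (f_linear : forall i : 'I_n, linear_on X (fun x => f x (y i)))
    (XT_represented : represents X f y A B c)
    (XT_nonempty : feasible_set f y A B c !=set0)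
    (XT_closed : closed (feasible_set f y A B c))
    (XT_convex : convex_set (feasible_set f y A B c))
    (alpha_level : 0 <= alpha <= 1)
    (gamma_level : 0 <= gamma <= 1)
    (alpha_lt_gamma : alpha < gamma)
    (delta_ge0 : 0 <= delta)
    (delta'_ge0 : 0 <= delta')
    (alpha_delta_level : 0 <= alpha + delta <= 1)
    (gamma_delta'_level : 0 <= gamma + delta' <= 1)
    (shifted_lt : alpha + delta < gamma + delta') :
  (optimal_value (feasible_set f y A B c)
     (fun xt => range_mean p xt.2 alpha gamma)
   <= optimal_value (feasible_set f y A B c)
     (fun xt => range_mean p xt.2 (alpha + delta) (gamma + delta')))%E.
Proof.
case: Y_discrete => _ _ _ p_gt0 p_sum1.
case/andP: alpha_level => alpha_ge0 _.
case/andP: gamma_delta'_level => _ gamma_le1.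
apply: le_ereal_inf_tmp => _ [xt XTxt <-].
apply: (@le_trans _ _ (range_mean p xt.2 alpha gamma)%:E).
  by apply: ereal_inf_lbound; exists xt.
by rewrite lee_fin; apply: range_mean_le => //; rewrite lerDl.
Qed.
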